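(* Let $M\in\mathbb{C}^{n\times n}$ satisfy $\mathrm{Ind}(M)\le 1$ and let $r=\mathrm{rk}(M)$. Let $L\in\mathbb{C}^{n\times(n-r)}$ with $\mathrm{rk}(L)=n-r$ and $\mathcal{R}(L)=\mathcal{N}(M^\ast)$. Then $$M^{\mathrm{core}}=\left(MM^\ast M+LL^\ast\right)^{-1}MM^\ast$$ (in particular, the inverse on the right-hand side exists).
   Context: $\mathcal{R}(\cdot)$ and $\mathcal{N}(\cdot)$ denote range (column space) and null space, and $^\ast$ the conjugate transpose. The index $\mathrm{Ind}(M)$ of a singular $M\in\mathbb{C}^{n\times n}$ is the smallest positive integer $k$ with $\mathrm{rk}(M^{k+1})=\mathrm{rk}(M^k)$; the index of a nonsingular matrix is $0$. For $M\in\mathbb{C}^{n\times n}$ with $\mathrm{Ind}(M)\le 1$, the core inverse $M^{\mathrm{core}}$ is the unique matrix $X\in\mathbb{C}^{n\times n}$ satisfying $MXM=M$, $MX^2=X$ and $(MX)^\ast=MX$. *)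

(* Defs.v *)
From mathcomp Require Import all_boot all_order all_algebra.
From mathcomp Require Import boolp classical_sets reals.
From mathcomp Require Export complex.
Set Implicit Arguments.
Unset Strict Implicit.
Unset Printing Implicit Defensive.
Import Order.TTheory GRing.Theory Num.Theory.
Local Open Scope ring_scope.
Local Open Scope sesquilinear_scope.

(* Vectors are columns and matrices act on the left; MathComp's row-space
   operations (kermx, <=%MS, ...) would instead give row spaces and left
   kernels. *)
Definition colspace (F : fieldType) (m n : nat) (A : 'M[F]_(m, n)) :
  set 'cV[F]_m := range (fun y : 'cV[F]_n => A *m y).

Definition nullspace (F : fieldType) (m n : nat) (A : 'M[F]_(m, n)) :
  set 'cV[F]_n := [set x | A *m x = 0]%classic.

Lemma mxindex_exists (F : fieldType) (n : nat) (M : 'M[F]_n) :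
  exists k, (0 < k)%N && (\rank (M ^+ k.+1) == \rank (M ^+ k)).
Proof.
have le_rk k : (\rank (M ^+ k.+1) <= \rank (M ^+ k))%N.
  by rewrite exprS mxrankM_maxr.
have [[k Hk]|H] := pselect (exists k, \rank (M ^+ k.+2) = \rank (M ^+ k.+1)).
  by exists k.+1; rewrite Hk eqxx.
have lt_rk k : (\rank (M ^+ k.+1) + k <= n)%N.
  elim: k => [|k IHk]; first by rewrite addn0 rank_leq_row.
  apply: leq_trans IHk; rewrite addnS -addSn leq_add2r ltn_neqAle le_rk andbT.
  by apply/eqP => Hk; apply: H; exists k.
have rk0 : \rank (M ^+ n.+1) = 0%N.
  by apply/eqP; rewrite -leqn0 -(leq_add2r n); exact: lt_rk.
by exists n.+1; rewrite /= rk0 -leqn0 -rk0.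
Qed.

Definition mxindex (F : fieldType) (n : nat) (M : 'M[F]_n) : nat :=
  if M \in unitmx then 0%N else ex_minn (mxindex_exists M).

Definition is_core_inverse (C : numClosedFieldType) (n : nat)
  (M X : 'M[C]_n) : Prop :=
  [/\ M *m X *m M = M, M *m X ^+ 2 = X & (M *m X)^t* = M *m X].

(* Meaningful when mxindex M <= 1, by core_inverse_existsu and core_inverseP below; 0 if M has no
   core inverse. *)
Definition core_inverse (C : numClosedFieldType) (n : nat) (M : 'M[C]_n) :
  'M[C]_n := xget 0 (is_core_inverse M).

Lemma mxindex_le1 (F : fieldType) (n : nat) (M : 'M[F]_n) :
  (mxindex M <= 1)%N -> \rank (M *m M) = \rank M.
Proof.
rewrite /mxindex; case: ifP => [uM _|_].
  by rewrite mxrankMfree // row_free_unit.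
case: ex_minnP => k /andP[k0 /eqP rk] _ k1.
by move: rk; rewrite (_ : k = 1%N) ?expr2 ?expr1 //; case: k k0 k1 => [|[]].
Qed.

Lemma mulmx_ctr_eq0 (C : numClosedFieldType) (m n : nat) (A : 'M[C]_(m, n)) :
  A *m A^t* = 0 -> A = 0.
Proof.
move=> A0; apply/matrixP => i j; rewrite mxE.
have /matrixP/(_ i i) := A0; rewrite !mxE.
under eq_bigr do rewrite !mxE -normCK.
move/psumr_eq0P => H; apply/eqP; rewrite -normr_eq0 -sqrf_eq0.
by rewrite H // => k _; rewrite exprn_ge0.
Qed.

Lemma ctr_mul (C : numClosedFieldType) (m n p : nat) (A : 'M[C]_(m, n))
  (B : 'M[C]_(n, p)) : (A *m B)^t* = B^t* *m A^t*.
Proof. by rewrite trmx_mul map_mxM. Qed.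

Lemma core_inverse_existsu (C : numClosedFieldType) (n : nat) (M : 'M[C]_n) :
  (mxindex M <= 1)%N -> exists! X, is_core_inverse M X.
Proof.
move=> /mxindex_le1 rkM2.
have := col_base_full M; have := row_base_free M; have := mulmx_base M.
move: (col_base M) (row_base M) => /= F G FG Gfree Ffull; pose K := G *m F.
have uK : K \in unitmx.
  rewrite -row_free_unit /row_free eqn_leq rank_leq_row /=.
  rewrite -{1}rkM2 -{1 2}FG mulmxA -(mulmxA F) mxrankMfree //.
  exact: mxrankM_maxr.
have [F' F'F] := row_fullP Ffull.
have uN : F^t* *m F \in unitmx.
  rewrite -row_free_unit -kermx_eq0; apply/eqP.
  have := mulmx_ker (F^t* *m F); set V := kermx _ => V0.
  have W0 : V *m F^t* = 0.
    apply: mulmx_ctr_eq0.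
    by rewrite ctr_mul trmxCK !mulmxA -(mulmxA V) V0 mul0mx.
  have /(congr1 (fun A => A^t*)) := F'F.
  rewrite ctr_mul trmx1 map_mx1 => F'F2.
  by rewrite -[V]mulmx1 -F'F2 mulmxA W0 mul0mx.
pose N := F^t* *m F.
have NN : N^t* = N by rewrite /N ctr_mul trmxCK.
pose P : 'M[C]_n := F *m invmx N *m F^t*.
pose X : 'M[C]_n := F *m invmx K *m invmx N *m F^t*.
have MX : M *m X = P.
  rewrite -FG /X !mulmxA -(mulmxA F G) -/K -(mulmxA F K) mulmxV //.
  by rewrite mulmx1.
have PF : P *m F = F by rewrite /P -!mulmxA mulVmx // mulmx1.
have PM : P *m M = M by rewrite -FG mulmxA PF.
have PX : P *m X = X by rewrite /X !mulmxA PF.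
have PH : P^t* = P.
  rewrite /P !ctr_mul trmxCK trmx_inv map_invmx NN.
  by rewrite mulmxA.
clearbody X; exists X; split.
  split; rewrite ?MX //.
  by rewrite expr2 (_ : X * X = X *m X) // mulmxA MX.
move=> Y [YM MYY YH].
have PY : P = M *m Y.
  have PQ : P *m (M *m Y) = M *m Y by rewrite mulmxA PM.
  have QP : M *m Y *m P = P by rewrite -MX mulmxA YM.
  by rewrite -PH -QP ctr_mul PH YH PQ.
have YP : P *m Y = Y by rewrite PY -[in RHS]MYY expr2
    (_ : Y * Y = Y *m Y) // mulmxA.
have inj (A : 'M[C]_n) : M *m (P *m A) = 0 -> P *m A = 0.
  rewrite /P -!mulmxA; move: (invmx N *m _) => B.
  have -> : M *m (F *m B) = F *m (K *m B).
    by rewrite /K -(mulmxA G) (mulmxA F G) FG.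
  move=> H.
  have KB0 : K *m B = 0 by rewrite -[K *m B]mul1mx -F'F -mulmxA H mulmx0.
  by rewrite -[B](mulKmx uK) KB0 !mulmx0.
apply/eqP; rewrite -subr_eq0 -PX -YP -mulmxBr; apply/eqP/inj.
by rewrite mulmxBr PX YP mulmxBr MX -PY subrr.
Qed.

Lemma core_inverseP (C : numClosedFieldType) (n : nat) (M : 'M[C]_n) :
  (mxindex M <= 1)%N -> is_core_inverse M (core_inverse M).
Proof.
by move=> /core_inverse_existsu[X [HX _]]; apply: xgetPex; exists X.
Qed.

(* Main.v *)
Require Import Defs.
From mathcomp Require Import all_boot all_order all_algebra.
From mathcomp Require Import classical_sets reals.
Import Order.TTheory GRing.Theory Num.Theory.
Local Open Scope ring_scope.
Local Open Scope sesquilinear_scope.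

(** Put [A = M M^* M + L L^*] and let [X] be the core inverse of [M].  The
    condition on [L] says that its columns span the orthogonal complement of
    the range of [M].

    The formula amounts to [A X = M M^*].  Since [X = M X^2] has its range
    inside that of [M], which is orthogonal to that of [L], the term
    [L L^* X] vanishes; and [M^* M X = M^*], because [M X] is Hermitian and
    fixes [M] ([ctr_mul_core_inverse]).

    For the invertibility of [A], let [A v = 0].  The ranges of [M] and [L]
    are orthogonal, so both terms of [A v] vanish, and cancelling Gram
    matrices ([ctr_mulmx_cancel]) leaves [M v = 0] and [L^* v = 0].  The second
    equation puts [v] in the range of [M].  Index at most 1 means that this
    range meets the null space of [M] only in 0, hence [v = 0]. *)

(** Testing the two inclusions on single columns is enough to obtain matrix
    identities: [B A = 0], and factorization through [A] of every matrix
    killed by [B]. *)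
Lemma colspace_sub_nullspace {F : fieldType} {m n p : nat}
    {A : 'M[F]_(m, n)} {B : 'M[F]_(p, m)} :
  (colspace A `<=` nullspace B)%classic -> B *m A = 0.
Proof.
move=> sAB; apply/trmx_inj/row_matrixP => j.
rewrite -tr_col trmx0 row0 colE -mulmxA.
have : nullspace B (A *m delta_mx j 0) by apply: sAB; exists (delta_mx j 0).
by rewrite /nullspace /= => ->; rewrite trmx0.
Qed.

Lemma nullspace_sub_colspace {F : fieldType} {m n p q : nat}
    {A : 'M[F]_(m, n)} {B : 'M[F]_(p, m)} {N : 'M[F]_(m, q)} :
  (nullspace B `<=` colspace A)%classic -> B *m N = 0 ->
  exists Y, N = A *m Y.
Proof.
move=> sBA BN0.
suff /submxP[Y NY] : (N^T <= A^T)%MS.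
  by exists Y^T; apply: trmx_inj; rewrite NY trmx_mul trmxK.
apply/row_subP => j; rewrite -tr_col.
have [|y _ <-] := sBA (col j N); last by rewrite trmx_mul submxMl.
by rewrite /nullspace /= colE mulmxA BN0 mul0mx.
Qed.

(** The columns of [A V] have squared norms on the diagonal of
    [V^* (A^* A V)]. *)
Lemma ctr_mulmx_cancel {C : numClosedFieldType} {m n p : nat}
    {A : 'M[C]_(m, n)} {V : 'M[C]_(n, p)} :
  A^t* *m (A *m V) = 0 -> A *m V = 0.
Proof.
move=> AAV0; rewrite -[LHS]trmxCK.
suff -> : (A *m V)^t* = 0 by rewrite trmx0 map_mx0.
by apply: mulmx_ctr_eq0; rewrite trmxCK {1}ctr_mul -mulmxA AAV0 mulmx0.
Qed.

(** With [M = Z M^2], a null vector [M u] of [M] is [Z M (M u) = 0]. *)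
Lemma mxindex_le1_cancel {F : fieldType} {n p : nat} {M : 'M[F]_n}
    {U : 'M[F]_(n, p)} :
  (mxindex M <= 1)%N -> M *m (M *m U) = 0 -> M *m U = 0.
Proof.
move=> /mxindex_le1 rkM2 MMU0.
have /submxP[Z MZ] : (M <= M *m M)%MS.
  by rewrite -(geq_leqif (mxrank_leqif_sup (submxMl M M))) rkM2.
by rewrite {1}MZ -!mulmxA MMU0 mulmx0.
Qed.

Lemma ctr_mul_core_inverse {C : numClosedFieldType} {n : nat}
    {M X : 'M[C]_n} :
  is_core_inverse M X -> M^t* *m (M *m X) = M^t*.
Proof. by case=> MXM _ MXH; rewrite -MXH -ctr_mul MXM. Qed.

Lemma ctr_compl_mul {C : numClosedFieldType} {n k : nat} {M : 'M[C]_n}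
    {L : 'M[C]_(n, k)} :
  colspace L = nullspace (M^t*) -> L^t* *m M = 0.
Proof.
move=> LE; have : M^t* *m L = 0 by apply: colspace_sub_nullspace; rewrite LE.
move/(congr1 (fun B => B^t*)).
by rewrite ctr_mul trmxCK trmx0 map_mx0.
Qed.

(** [M X] is the orthogonal projector onto the range of [M], so [1 - M X] is
    Hermitian and factors through [L] on the left, hence through [L^*] on the
    right. *)
Lemma ctr_compl_kernel {C : numClosedFieldType} {n k p : nat} {M X : 'M[C]_n}
    {L : 'M[C]_(n, k)} {V : 'M[C]_(n, p)} :
  is_core_inverse M X -> colspace L = nullspace (M^t*) ->
  L^t* *m V = 0 -> V = M *m X *m V.
Proof.
move=> coreX LE LV0; have [_ _ MXH] := coreX.
have [||Y PY] := @nullspace_sub_colspace _ _ _ _ _ L (M^t*) (1%:M - M *m X).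
- by rewrite LE.
- by rewrite mulmxBr mulmx1 (ctr_mul_core_inverse coreX) subrr.
have PH : (1%:M - M *m X)^t* = 1%:M - M *m X.
  by rewrite linearB /= map_mxB MXH trmx1 map_mx1.
apply/eqP; rewrite -subr_eq0 -{1}[V]mul1mx -mulmxBl -PH PY ctr_mul.
by rewrite -mulmxA LV0 mulmx0.
Qed.

Lemma bordered_mul_core_inverse {C : numClosedFieldType} {n k : nat}
    {M X : 'M[C]_n} {L : 'M[C]_(n, k)} :
  is_core_inverse M X -> colspace L = nullspace (M^t*) ->
  (M *m M^t* *m M + L *m L^t*) *m X = M *m M^t*.
Proof.
move=> coreX LE; have [_ MXX _] := coreX.
have LX0 : L^t* *m X = 0 by rewrite -MXX mulmxA (ctr_compl_mul LE) mul0mx.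
by rewrite mulmxDl -!mulmxA LX0 mulmx0 addr0 (ctr_mul_core_inverse coreX).
Qed.

Lemma bordered_unit {C : numClosedFieldType} {n k : nat} {M X : 'M[C]_n}
    {L : 'M[C]_(n, k)} :
  is_core_inverse M X -> colspace L = nullspace (M^t*) ->
  (mxindex M <= 1)%N -> M *m M^t* *m M + L *m L^t* \in unitmx.
Proof.
move=> coreX LE hM; set A := _ + _.
rewrite -row_full_unit -cokermx_eq0; apply/eqP.
(* The columns of V span the null space of A. *)
have := mulmx_coker A; set V := cokermx A.
rewrite mulmxDl -!mulmxA => AV0.
(* Orthogonality of the two ranges: multiplying by L^* kills the first
   term. *)
have LV0 : L^t* *m V = 0.
  have LLV0 : L *m (L^t* *m V) = 0.
    apply: ctr_mulmx_cancel.
    have := congr1 (mulmx (L^t*)) AV0.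
    by rewrite mulmxDr mulmx0 (mulmxA _ M) (ctr_compl_mul LE) mul0mx add0r.
  by apply: ctr_mulmx_cancel; rewrite trmxCK.
have MV0 : M *m V = 0.
  apply: ctr_mulmx_cancel; apply: ctr_mulmx_cancel; rewrite trmxCK.
  by move: AV0; rewrite LV0 mulmx0 addr0.
have VE := ctr_compl_kernel coreX LE LV0.
by rewrite VE -mulmxA mxindex_le1_cancel // (mulmxA M X) -VE.
Qed.

Theorem theorem3p5 (R : realType) (n : nat) (M : 'M[R[i]]_n)
    (hM : (mxindex M <= 1)%N)
    (L : 'M[R[i]]_(n, n - \rank M))
    (hLrank : \rank L = (n - \rank M)%N)
    (hLrange : colspace L = nullspace (M^t*)) :
  M *m M^t* *m M + L *m L^t* \in unitmx /\
  core_inverse M = invmx (M *m M^t* *m M + L *m L^t*) *m (M *m M^t*).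
Proof.
have coreX := core_inverseP hM.
have uA := bordered_unit coreX hLrange hM.
split=> //.
exact: (canRL (mulKmx uA) (bordered_mul_core_inverse coreX hLrange)).
Qed.
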